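(* Let $a>0$, $b>0$, $c>0$ be real numbers and let $\Delta\subset\mathbb{R}^2$ be the closed triangle (boundary and interior points included) with vertices $A(0,a)$, $B(-b,0)$ and $C(c,0)$. Let $n\geq 2$ be an integer, and put $$p=\sqrt{a^{2}+b^{2}},\quad q=\sqrt{a^{2}+c^{2}},\quad t=\left(\frac{p}{q}\right)^{\frac{1}{n-1}},\quad r=\left(\frac{b+c}{q}\right)^{\frac{1}{n-1}},\quad \lambda=q+br+cr+pt.$$ Then the minimum over the closed triangle $\Delta$ of the function $$F(x,y)=\left(\frac{ax-by+ab}{\sqrt{a^{2}+b^{2}}}\right)^{n}+\left(\frac{-ax-cy+ac}{\sqrt{a^{2}+c^{2}}}\right)^{n}+y^{n}$$ is $$\frac{a^{n}}{\lambda^{n}}(b+c)^{n}\left[t^{n}+r^{n}+1\right],$$ and it is attained at the point $(x_{\min},y_{\min})$, which lies inside (in the interior of) the triangle, where $$x_{\min}=-\frac{bq-cpt}{\lambda},\qquad y_{\min}=\frac{abr+acr}{\lambda}.$$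
   Context: The closed triangle is $\Delta=\{(x,y)\in\mathbb{R}^2 : ax-by+ab\geq 0,\ -ax-cy+ac\geq 0,\ y\geq 0\}$. For a point of $\Delta$, the three quantities $\frac{ax-by+ab}{\sqrt{a^2+b^2}}$, $\frac{-ax-cy+ac}{\sqrt{a^2+c^2}}$ and $y$ are its distances to the sides $AB$, $AC$ and $BC$ respectively, so $F$ is the sum of the $n$-th powers of the distances to the sides. Roots are positive real roots. *)

(* Defs.v *)
(* The plane is represented by R * R, with its product topology. *)
From HB Require Import structures.
From mathcomp Require Import all_boot all_order all_algebra.
From mathcomp Require Import all_classical all_reals all_analysis.

Set Implicit Arguments.
Unset Strict Implicit.
Unset Printing Implicit Defensive.

Import Order.TTheory GRing.Theory Num.Theory.
Import numFieldNormedType.Exports.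

Local Open Scope classical_set_scope.
Local Open Scope ring_scope.

(* The closed triangle with vertices A(0,a), B(-b,0), C(c,0), as the
   intersection of the closed half-planes bounded by AB, AC and BC. *)
Definition triangle (R : realType) (a b c : R) : set (R * R) :=
  [set z | [/\ 0 <= a * z.1 - b * z.2 + a * b,
               0 <= - a * z.1 - c * z.2 + a * c
             & 0 <= z.2]].

(* On [triangle a b c] the three bases are the distances of z to the lines
   AB, AC and BC. *)
Definition sum_dist_pow (R : realType) (a b c : R) (n : nat) (z : R * R) : R :=
  ((a * z.1 - b * z.2 + a * b) / Num.sqrt (a ^+ 2 + b ^+ 2)) ^+ n
  + ((- a * z.1 - c * z.2 + a * c) / Num.sqrt (a ^+ 2 + c ^+ 2)) ^+ n
  + z.2 ^+ n.

Definition is_minimum (R : realType) (A : set R) (m : R) : Prop :=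
  A m /\ lbound A m.

(* Main.v *)
(* The distances u, v, w to AB, AC, BC satisfy p u + q v + (b + c) w = a (b + c),
   twice the area.  At u : v : w = t : 1 : r the gradient of u^n + v^n + w^n is
   proportional to (p, q, b + c), so the first-order terms of the tangent-line
   inequality for the convex function s^n cancel on that plane. *)
Require Import Defs.
From HB Require Import structures.
From mathcomp Require Import all_boot all_order all_algebra.
From mathcomp Require Import all_classical all_reals all_analysis.
From mathcomp Require Import ring lra.
Import Order.TTheory GRing.Theory Num.Theory.
Import numFieldNormedType.Exports.
Local Open Scope classical_set_scope.
Local Open Scope ring_scope.

(** Induction on [m]: multiplying the bound for one exponent by [x] exceeds the bound for the next
    by [k * y ^+ m * (x - y) ^+ 2], which is nonnegative. *)
Lemma exprS_ge_tangent (R : realDomainType) (x y : R) (m : nat) :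
  0 <= x -> 0 <= y -> y ^+ m.+1 + m.+1%:R * y ^+ m * (x - y) <= x ^+ m.+1.
Proof.
move=> x0 y0; elim: m => [|m IH]; first by rewrite !expr1 expr0; lra.
rewrite [leRHS]exprS; apply: le_trans (ler_wpM2l x0 IH).
rewrite -subr_ge0 !exprS -[m.+2%:R]natr1.
set k := m.+1%:R.
have -> : x * (y * y ^+ m + k * y ^+ m * (x - y)) -
    (y * (y * y ^+ m) + (k + 1) * (y * y ^+ m) * (x - y)) =
    k * y ^+ m * (x - y) ^+ 2 by ring.
apply: mulr_ge0; last exact: sqr_ge0.
by apply: mulr_ge0; [exact: ler0n | exact: exprn_ge0].
Qed.

Lemma powR_invn_exprn (R : realType) (s : R) (m : nat) :
  0 <= s -> (0 < m)%N -> (s `^ (1 / m%:R)) ^+ m = s.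
Proof.
move=> s0 m0; rewrite -powR_mulrn ?powR_ge0 // -powRrM.
by rewrite div1r mulVf ?powRr1 // pnatr_eq0 -lt0n.
Qed.

Lemma near_affine_gt0 (R : realType) (a b d : R) (z0 : R * R) :
  0 < a * z0.1 + b * z0.2 + d -> \forall z \near z0, 0 < a * z.1 + b * z.2 + d.
Proof.
move=> h.
have cf : (fun z : R * R => a * z.1 + b * z.2 + d) @ z0 -->
    a * z0.1 + b * z0.2 + d.
  apply: cvgD; last exact: cvg_cst.
  by apply: cvgD; apply: cvgM;
    by [exact: cvg_cst | exact: cvg_fst | exact: cvg_snd].
exact: (cvgr_gt _ cf).
Qed.

(** Each strict affine inequality persists near [z0] by continuity, and a neighbourhood where all
    three hold lies in the triangle. *)
Lemma triangle_interior (R : realType) (a b c : R) (z0 : R * R) :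
  0 < a * z0.1 - b * z0.2 + a * b -> 0 < - a * z0.1 - c * z0.2 + a * c ->
  0 < z0.2 -> (triangle a b c)° z0.
Proof.
rewrite -[_ - b * _]/(_ + - (b * _)) -mulNr => h1.
rewrite -[_ - c * _]/(_ + - (c * _)) -mulNr => h2 h3.
(* Puts the third inequality in the affine form of [near_affine_gt0]. *)
have h3' : 0 < 0 * z0.1 + 1 * z0.2 + 0 by lra.
rewrite /interior /=.
near=> z; split; last 1 first.
- suff : 0 < 0 * z.1 + 1 * z.2 + 0 by lra.
  by near: z; exact: near_affine_gt0.
- rewrite -mulNr ltW //.
  by near: z; exact: near_affine_gt0.
- rewrite -[- (c * _)]mulNr ltW //.
  by near: z; exact: near_affine_gt0.
Unshelve. all: by end_near. Qed.

(** The last equation puts [(u, v, w)] on the plane with normal [(p, q, s)] through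
    [(k * t, k, k * r)]; tangents are taken at the latter point. *)
Lemma weighted_sum_pow_ge (R : realFieldType) (p q s t r k u v w : R) (m : nat) :
  0 < q -> 0 <= t -> 0 <= r -> 0 <= k ->
  t ^+ m = p / q -> r ^+ m = s / q ->
  0 <= u -> 0 <= v -> 0 <= w ->
  p * u + q * v + s * w = k * (p * t + q + s * r) ->
  k ^+ m.+1 * (t ^+ m.+1 + r ^+ m.+1 + 1) <=
    u ^+ m.+1 + v ^+ m.+1 + w ^+ m.+1.
Proof.
move=> q0 t0 r0 k0 tE rE u0 v0 w0 E.
have hu := exprS_ge_tangent _ _ _ m u0 (mulr_ge0 k0 t0).
have hv := exprS_ge_tangent _ _ _ m v0 k0.
have hw := exprS_ge_tangent _ _ _ m w0 (mulr_ge0 k0 r0).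
apply: le_trans (lerD (lerD hu hv) hw).
(* The tangent slopes become [m.+1%:R * k ^+ m / q] times [p], [q], [s], so the bound holds with
   equality. *)
rewrite !exprMn tE rE le_eqVlt; apply/orP; left; apply/eqP.
have first_order_term : m.+1%:R * k ^+ m / q *
  (p * u + q * v + s * w - k * (p * t + q + s * r)) = 0.
  by rewrite E subrr mulr0.
rewrite -[LHS]addr0 -first_order_term; field.
by rewrite gt_eqF.
Qed.

Theorem theorem1 (R : realType) (a b c : R) (n : nat)
    (ha : 0 < a) (hb : 0 < b) (hc : 0 < c) (hn : (2 <= n)%N) :
  let p := Num.sqrt (a ^+ 2 + b ^+ 2) in
  let q := Num.sqrt (a ^+ 2 + c ^+ 2) in
  let t := (p / q) `^ (1 / (n%:R - 1)) in
  let r := ((b + c) / q) `^ (1 / (n%:R - 1)) in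
  let lambda := q + b * r + c * r + p * t in
  let m := a ^+ n / lambda ^+ n * (b + c) ^+ n * (t ^+ n + r ^+ n + 1) in
  let xmin := - ((b * q - c * p * t) / lambda) in
  let ymin := (a * b * r + a * c * r) / lambda in
  [/\ is_minimum (sum_dist_pow a b c n @` triangle a b c) m,
      sum_dist_pow a b c n (xmin, ymin) = m
    & (triangle a b c)° (xmin, ymin)].
Proof.
move=> p q t r lambda m xmin ymin.
(* From here the exponent is [n.+1], so [t] and [r] are [n]-th roots, with [n] positive by [hn]. *)
case: n hn @t @r @lambda @m @xmin @ymin => [//|n] hn t r lambda m xmin ymin.
have p0 : 0 < p by rewrite sqrtr_gt0 addr_gt0 ?exprn_gt0.
have q0 : 0 < q by rewrite sqrtr_gt0 addr_gt0 ?exprn_gt0.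
have bc0 : 0 < b + c by exact: addr_gt0.
have n1 : n.+1%:R - 1 = n%:R :> R by rewrite -natr1 addrK.
have t0 : 0 < t by rewrite powR_gt0 // divr_gt0.
have r0 : 0 < r by rewrite powR_gt0 // divr_gt0.
have tE : t ^+ n = p / q.
  by rewrite /t n1 powR_invn_exprn // ltW // divr_gt0.
have rE : r ^+ n = (b + c) / q.
  by rewrite /r n1 powR_invn_exprn // ltW // divr_gt0.
have l0 : 0 < lambda by rewrite !addr_gt0 ?mulr_gt0.
have lN : lambda != 0 by rewrite gt_eqF.
have pN : p != 0 by rewrite gt_eqF.
have qN : q != 0 by rewrite gt_eqF.
(* Since [lambda] is [p * t + q + (b + c) * r], this scale puts [k * (t, 1, r)] on the plane of
   distance triples. *)
pose k := a * (b + c) / lambda.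
have k0 : 0 < k by rewrite divr_gt0 ?mulr_gt0.
have mE : m = k ^+ n.+1 * (t ^+ n.+1 + r ^+ n.+1 + 1).
  by rewrite /m /k !exprMn exprVn; congr (_ * _); rewrite mulrAC.
(* The candidate point has distances [k * t], [k], [k * r] to AB, AC, BC: it is the point of
   tangency. *)
have uE : a * xmin - b * ymin + a * b = p * (k * t).
  by rewrite /xmin /ymin /k; move: lN; rewrite /lambda => lN; field.
have vE : - a * xmin - c * ymin + a * c = q * k.
  by rewrite /xmin /ymin /k; move: lN; rewrite /lambda => lN; field.
have yE : ymin = k * r by rewrite /ymin /k; field.
have FE : sum_dist_pow a b c n.+1 (xmin, ymin) = m.
  rewrite /sum_dist_pow /= uE vE -/p -/q yE mE.
  rewrite ![_ * _ / _]mulrAC !divff // !mul1r !exprMn; ring.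
have inner : (triangle a b c)° (xmin, ymin).
  by apply: triangle_interior; rewrite /= ?uE ?vE ?yE;
    do ?[exact: mulr_gt0 | apply: mulr_gt0].
split => //; split.
  by exists (xmin, ymin) => //; exact: interior_subset inner.
move=> _ [[x y] [/= h1 h2 h3] <-].
rewrite mE /sum_dist_pow /= -/p -/q.
apply: (weighted_sum_pow_ge _ _ _ _ _ _ _ _ _ _ _
  q0 (ltW t0) (ltW r0) (ltW k0) tE rE) => //.
- by rewrite divr_ge0 // ltW.
- by rewrite divr_ge0 // ltW.
(* The area identity: [x] cancels on the left, and both sides equal [a * (b + c)]. *)
rewrite /k; move: lN; rewrite /lambda => lN; field.
by rewrite pN qN lN.
Qed.
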